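(* Let $X=(x(1),\dots,x(m))\in[n]^m$ be an access sequence with relative frequencies $\mathbf{p}_x=|\{i: x(i)=x\}|/m$, and let $\mathbf{q}$ be an estimate of $\mathbf{p}$, a probability distribution on $[n]$ with $\mathbf{q}_x>0$ for all $x$. For each item $x\in[n]$ draw $\delta_x\sim U(0,1)$ and set $$\mathrm{pri}_x := -\left\lfloor \log_2\log_2 \frac{1}{\mathbf{q}_x}\right\rfloor + \delta_x.$$ In the corresponding Treap each node $x$ has expected depth $O(\log(1/\mathbf{q}_x))$, and the expected total time for processing the access sequence is $O(m\cdot \mathrm{Ent}(\mathbf{p},\mathbf{q}))$, where $\mathrm{Ent}(\mathbf{p},\mathbf{q})=\sum_x \mathbf{p}_x\log(1/\mathbf{q}_x)$ is the cross entropy.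
   Context: A Treap with distinct priorities is the unique BST on keys $[n]$ with the heap property on priorities. Accessing an item costs its depth (number of ancestors including itself). The offsets $\delta_x$ are uniform on $(0,1)$ drawn via an $11$-wise independent hash function.
   Formalization: The bounds are proved as O(max(1, log(1/q_x))) and O(m·max(1, Ent(p,q))), since every depth is at least 1 while log(1/q_x) and Ent can be 0 or arbitrarily small (e.g. n = 1, q_1 = 1). *)

(* Defs.v *)
From HB Require Import structures.
From mathcomp Require Import all_boot all_order all_algebra.
From mathcomp Require Import all_classical all_reals all_analysis.

Set Implicit Arguments.
Unset Strict Implicit.
Unset Printing Implicit Defensive.

Import Order.TTheory GRing.Theory Num.Theory.
Import numFieldNormedType.Exports.

Local Open Scope classical_set_scope.
Local Open Scope ring_scope.

(* Binary trees with nodes labelled by keys. The key set [n] is 'I_n. *)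
Inductive tree (n : nat) : Type :=
| Leaf
| Node of tree n & 'I_n & tree n.
Arguments Leaf {n}.
Arguments Node {n} _ _ _.

HB.instance Definition _ (n : nat) := gen_eqMixin (tree n).
HB.instance Definition _ (n : nat) := gen_choiceMixin (tree n).

Fixpoint keys (n : nat) (t : tree n) : seq 'I_n :=
  if t is Node l k r then keys l ++ k :: keys r else [::].

Fixpoint bst (n : nat) (t : tree n) : bool :=
  if t is Node l k r then
    [&& bst l, bst r, all (fun y : 'I_n => (y < k)%N) (keys l)
      & all (fun y : 'I_n => (k < y)%N) (keys r)]
  else true.

(* Max-heap: a node has priority at least that of each of its descendants. *)
Fixpoint heap (R : realType) (n : nat) (pri : 'I_n -> R) (t : tree n) : bool :=
  if t is Node l k r then
    [&& heap pri l, heap pri r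
      & all (fun y => pri y <= pri k) (keys l ++ keys r)]
  else true.

Definition is_treap (R : realType) (n : nat) (pri : 'I_n -> R) (t : tree n)
    : Prop :=
  [/\ bst t, (forall x : 'I_n, x \in keys t) & heap pri t].

(* "The" Treap; see treapP and treap_unique. If several priorities coincide,
   some tree satisfying is_treap is chosen, depending only on the order of the
   priorities. *)
Definition treap (R : realType) (n : nat) (pri : 'I_n -> R) : tree n :=
  xget Leaf [set t | is_treap pri t].

(* The number of nodes of t whose subtree contains x, that is, the number of
   ancestors of x, including x itself. *)
Fixpoint depth (n : nat) (t : tree n) (x : 'I_n) : nat :=
  if t is Node l k r then
    ((x \in keys (Node l k r)) + depth l x + depth r x)%N
  else 0%N.

Lemma treap_exists_on (R : realType) (n : nat) (pri : 'I_n -> R)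
    (A : {set 'I_n}) :
  exists t : tree n, [/\ bst t, keys t =i A & heap pri t].
Proof.
have [m] := ubnP #|A|; elim: m A => // m IHm A ltAm.
have [->|[k0 k0A]] := set_0Vmem A.
  by exists Leaf; split=> // x; rewrite finset.in_set0.
case: (arg_maxP pri k0A) => k kA kmax.
have small (B : {set 'I_n}) : B \subset A -> k \notin B -> (#|B| < m)%N.
  move=> BA kB; rewrite -ltnS; apply: leq_trans ltAm; rewrite ltnS.
  by apply: proper_card; apply/properP; split => //; exists k.
have [l [bl kl hl]] : exists t : tree n,
    [/\ bst t, keys t =i [set y in A | (y < k)%N] & heap pri t].
  by apply/IHm/small; [apply/fintype.subsetP => y | ]; rewrite inE ?ltnn ?andbF // => /andP[].
have [r [br kr hr]] : exists t : tree n,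
    [/\ bst t, keys t =i [set y in A | (k < y)%N] & heap pri t].
  by apply/IHm/small; [apply/fintype.subsetP => y | ]; rewrite inE ?ltnn ?andbF // => /andP[].
exists (Node l k r); split => /=.
- rewrite bl br /=; apply/andP; split; apply/allP => y.
  + by rewrite kl inE => /andP[].
  + by rewrite kr inE => /andP[].
- move=> x; rewrite mem_cat inE kl kr !inE.
  case: (ltngtP x k) => [xk|xk|/val_inj ->]; rewrite ?andbT ?andbF ?eqxx /= ?kA //.
  + by case: eqP xk => [->|_]; rewrite ?ltnn ?orbF.
  + by case: eqP xk => [->|_]; rewrite ?ltnn.
- rewrite hl hr /=; apply/allP => y; rewrite mem_cat kl kr !inE.
  by case/orP => /andP[yA _]; exact: kmax.
Qed.

Lemma treapP (R : realType) (n : nat) (pri : 'I_n -> R) :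
  is_treap pri (treap pri).
Proof.
rewrite /treap; case: xgetP => [t _ //|none].
have [t [bt kt ht]] := treap_exists_on pri [set: 'I_n]%SET.
by case: (none t); split=> // x; rewrite kt inE.
Qed.

Lemma treap_unique_on (R : realType) (n : nat) (pri : 'I_n -> R)
    (t u : tree n) :
  injective pri -> bst t -> bst u -> keys t =i keys u ->
  heap pri t -> heap pri u -> t = u.
Proof.
move=> pri_inj; elim: t u => [|l IHl k r IHr] [|l' k' r'] //.
- by move=> _ _ /(_ k'); rewrite /= mem_cat !inE eqxx orbT.
- by move=> _ _ /(_ k); rewrite /= mem_cat !inE eqxx orbT.
move=> /= /and4P[bl br /allP al /allP ar] /and4P[bl' br' /allP al' /allP ar'].
move=> ek /and3P[hl hr /allP hk] /and3P[hl' hr' /allP hk'].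
have kk' : k = k'.
  apply: pri_inj; apply/eqP; rewrite eq_le; apply/andP; split.
  - have := ek k; rewrite !mem_cat !inE eqxx orbT => /esym.
    case: eqP => [-> //|_] /=; rewrite -mem_cat; exact: hk'.
  - have := ek k'; rewrite !mem_cat !inE eqxx orbT.
    case: eqP => [-> //|_] /=; rewrite -mem_cat; exact: hk.
subst k'; congr Node; [apply: IHl|apply: IHr] => // x;
  have := ek x; rewrite !mem_cat !inE;
  case: (ltngtP x k) => [xk|xk|/val_inj ->].
all: have notl (y : 'I_n) (s : seq 'I_n) :
    {in s, forall z : 'I_n, (z < k)%N} -> (k <= y)%N -> (y \in s) = false
  by move=> sk ky; apply: contraTF ky => /sk; rewrite ltnNge.
all: have notr (y : 'I_n) (s : seq 'I_n) :
    {in s, forall z : 'I_n, (k < z)%N} -> (y <= k)%N -> (y \in s) = false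
  by move=> sk ky; apply: contraTF ky => /sk; rewrite ltnNge.
- have -> : (x == k) = false by apply: contraTF xk => /eqP ->; rewrite ltnn.
  by rewrite (notr _ _ ar (ltnW xk)) (notr _ _ ar' (ltnW xk)) !orbF.
- by rewrite (notl _ _ al (ltnW xk)) (notl _ _ al' (ltnW xk)).
- by rewrite (notl _ _ al (leqnn k)) (notl _ _ al' (leqnn k)).
- by rewrite (notr _ _ ar (ltnW xk)) (notr _ _ ar' (ltnW xk)).
- have -> : (x == k) = false by apply: contraTF xk => /eqP ->; rewrite ltnn.
  by rewrite (notl _ _ al (ltnW xk)) (notl _ _ al' (ltnW xk)) !orFb.
- by rewrite (notr _ _ ar (leqnn k)) (notr _ _ ar' (leqnn k)).
Qed.

Lemma treap_unique (R : realType) (n : nat) (pri : 'I_n -> R) (t : tree n) :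
  injective pri -> is_treap pri t -> t = treap pri.
Proof.
move=> pri_inj [bt kt ht]; have [bu ku hu] := treapP pri.
by apply: (treap_unique_on pri_inj) => // x; rewrite kt ku.
Qed.

Definition log2 (R : realType) (x : R) : R := ln x / ln 2.

(* For n = 1 and q_x = 1 the double logarithm is undefined; log2 0 = 0 is then
   used, which is harmless since the tree has a single node. *)
Definition priority (R : realType) (n : nat) (q delta : 'I_n -> R) (x : 'I_n)
    : R :=
  - (Num.floor (log2 (log2 (q x)^-1)))%:~R + delta x.

Definition frequency (R : realType) (n m : nat) (X : m.-tuple 'I_n) (x : 'I_n) : R :=
  #|[set i | tnth X i == x]%SET|%:R / m%:R.

Definition cross_entropy (R : realType) (n : nat) (p q : 'I_n -> R) : R :=
  \sum_(x < n) p x * log2 (q x)^-1.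

Definition access_cost (n m : nat) (X : m.-tuple 'I_n) (t : tree n) : nat :=
  (\sum_(i < m) depth t (tnth X i))%N.

Definition kwise_independent (d : measure_display) (T : measurableType d)
    (R : realType) (P : probability T R) (k n : nat)
    (Y : 'I_n -> {RV P >-> R}) : Prop :=
  forall (J : {set 'I_n}) (B : 'I_n -> set R),
    (#|J| <= k)%N -> (forall i, measurable (B i)) ->
    P (\bigcap_(i in [set` J]) Y i @^-1` B i)
      = (\prod_(i in J) P (Y i @^-1` B i))%E.

(* U(0,1); its law is the library's uniform law on the closed unit interval. *)
Definition uniform01 (d : measure_display) (T : measurableType d)
    (R : realType) (P : probability T R) (Y : {RV P >-> R}) : Prop :=
  forall B : set R, measurable B ->
    distribution P Y B = uniform_prob (@ltr01 R) B.

(* The argument v of a bound O(v), taken to be at least 1. A depth is at least 1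
   whereas log(1/q_x) and the cross entropy can be arbitrarily close to 0 (when
   some q_x is close to 1), so O(v) is read as O(max(1, v)), which is literally
   O(v) as soon as v >= 1, e.g. when q_x <= 1/2. *)
Definition at_least1 (R : realType) (v : R) : R := Num.max 1 v.

(* Main.v *)
Require Import Defs.
From HB Require Import structures.
From mathcomp Require Import all_boot all_order all_algebra.
From mathcomp Require Import all_classical all_reals all_analysis.
From mathcomp Require Import measurable_realfun zify ring lra.

Set Implicit Arguments.
Unset Strict Implicit.
Unset Printing Implicit Defensive.

Import Order.TTheory GRing.Theory Num.Theory.
Import numFieldNormedType.Exports.

Local Open Scope classical_set_scope.
Local Open Scope ring_scope.

(** An ancestor [y] of [x] has maximal priority among all keys between [x] and
    [y], so the expected depth of [x] is at most the sum over [y] of the probability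
    of that event. Group the keys into tiers, tier [c] being those with
    [floor (log2 (log2 (1 / q y))) = c]; it has at most [2 ^ 2 ^ (c + 1)] elements
    because [q] sums to 1. Keys of a tier above that of [x] are almost surely not
    ancestors of [x], and the negative tiers have total weight at most 1 while each
    of their keys weighs at least [1 / 2]. Within a tier, the key with [r] tier
    members between itself and [x] is an ancestor only if its offset dominates
    [r] others, which under 5-wise independence has probability [O(1 / (r + 1))].
    The harmonic sum over a tier is [O(2 ^ c)], and these bounds form a geometric
    series dominated by [2 ^ level x <= log2 (1 / q x)].

    The [O(1 / (r + 1))] bound splits the competitors into two halves of size [h]
    and the top of [[0, 1]] into bins of width [1 / h]. Given that the winning
    offset lies in bin [s], a pairwise Chebyshev estimate on each half, multiplied
    together, gives probability [O(1 / s ^ 2)], which is summable in [s]. *)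

(** * Depth in a treap *)

Section TreeDepth.
Context {R : realType} {n : nat} (pri : 'I_n -> R).
Implicit Types (t : tree n) (x y z : 'I_n).

Definition between (x y : 'I_n) : pred 'I_n :=
  fun z => (minn x y <= z <= maxn x y)%N.

(** A substitute for ancestry that mentions no tree: a finite conjunction of comparisons of
    priorities, hence a measurable event. Ties are allowed. *)
Definition outranks (x y : 'I_n) : bool :=
  [forall z, between x y z ==> (pri z <= pri y)].

Lemma depth_notin t x : x \notin keys t -> depth t x = 0%N.
Proof.
elim: t => //= l IHl k r IHr xt; rewrite (negbTE xt) add0n.
move: xt; rewrite mem_cat inE !negb_or => /and3P[xl _ xr].
by rewrite IHl ?IHr.
Qed.

Lemma bst_uniq t : bst t -> uniq (keys t).
Proof.
elim: t => //= l IHl k r IHr /and4P[/IHl ul /IHr ur /allP al /allP ar].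
rewrite cat_uniq /= ul ur andbT /= negb_or -andbA; apply/and3P; split.
- by apply/negP => /al; rewrite ltnn.
- apply/hasPn => z /ar kz; apply/negP => /al zk.
  by have := ltn_trans kz zk; rewrite ltnn.
- by apply/negP => /ar; rewrite ltnn.
Qed.

(** Induction on the tree: the root adds at most one to the depth and dominates every key, and the
    remaining depth comes from the one subtree holding [x]. The comparison ranges over [keys t]
    only, so that the induction passes to subtrees. *)
Lemma depth_le_count t x : bst t -> heap pri t ->
  (depth t x <= count (fun y =>
     all (fun z => between x y z ==> (pri z <= pri y)%R) (keys t)) (keys t))%N.
Proof.
elim: t => //= l IHl k r IHr /and4P[bl br /allP al /allP ar].
move=> /and3P[hl hr /allP hk].
set a := fun y => all _ (keys l ++ _).
have ak : a k.
  apply/allP => z; rewrite mem_cat inE orbCA => /orP[/eqP->|zlr].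
    by rewrite lexx implybT.
  by rewrite hk ?implybT // mem_cat.
(* If every key of the tree between [x] and a key of [s] lies in [s], then domination inside [s] is
   domination in the whole tree. *)
have sub s : (forall y z, y \in keys s -> z \in keys l ++ k :: keys r ->
    between x y z -> z \in keys s) ->
    (count (fun y => all (fun z => between x y z ==> (pri z <= pri y)%R)
      (keys s)) (keys s) <= count a (keys s))%N.
  move=> H; set b := fun y => all _ (keys s).
  rewrite (@eq_in_count _ b (predI b (mem (keys s)))); last first.
    by move=> y ys /=; rewrite ys andbT.
  apply: sub_count => y /andP[/allP ay ys]; apply/allP => z zt.
  by apply/implyP => xyz; move: (ay _ (H y z ys zt xyz)); rewrite xyz.
rewrite count_cat /= ak mem_cat inE.
have [xl|xl] := boolP (x \in keys l).
  have xk := al _ xl.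
  have xr : x \notin keys r by apply/negP => /ar kx; lia.
  rewrite (depth_notin xr) addn0 /= addnCA leq_add2l.
  apply: leq_trans (leq_addr _ _); apply: leq_trans (IHl bl hl) (sub _ _).
  move=> y z /al yk; rewrite mem_cat inE => /or3P[//|/eqP->|/ar kz];
    by rewrite /between; lia.
have [xr|xr] := boolP (x \in keys r).
  have kx := ar _ xr.
  rewrite (depth_notin xl) addn0 orbT /= addnCA leq_add2l.
  apply: leq_trans (leq_addl _ _); apply: leq_trans (IHr br hr) (sub _ _).
  move=> y z /ar ky; rewrite mem_cat inE => /or3P[/al zk|/eqP->|//];
    by rewrite /between; lia.
rewrite (depth_notin xl) (depth_notin xr) !addn0 orbF /=.
by case: (x == k); lia.
Qed.

Lemma depth_treap_le x : (depth (treap pri) x <= \sum_y outranks x y)%N.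
Proof.
have [bt kt ht] := treapP pri; apply: leq_trans (depth_le_count x bt ht) _.
rewrite -size_filter.
have /card_uniqP <- := filter_uniq
  (fun y => all (fun z => between x y z ==> (pri z <= pri y)) (keys (treap pri)))
  (bst_uniq bt).
rewrite -sum1_card big_mkcond /=; apply: leq_sum => y _.
rewrite mem_filter; case: ifP => // /andP[/allP ay _].
by rewrite lt0b; apply/forallP => z; exact: ay.
Qed.

Lemma outranks_ler x y : outranks x y -> pri x <= pri y.
Proof. by move/forallP/(_ x)/implyP; apply; rewrite /between; lia. Qed.

End TreeDepth.

(** * Bounded random variables *)

Section BoundedMeasurable.
Context {d : measure_display} {T : measurableType d} {R : realType}.
Variable P : probability T R.
Implicit Types f g : T -> R.

(** A class closed under sums and products and integrable for [P], so that linearity of the mean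
    applies to every polynomial in indicators. *)
Definition bounded_mfun (f : T -> R) : Prop :=
  measurable_fun [set: T] f /\ exists M, forall w, `|f w| <= M.

Definition mean (f : T -> R) : R := (\int[P]_w f w)%R.

Lemma bounded_mfun_cst c : bounded_mfun (fun=> c).
Proof. by split=> //; exists `|c|. Qed.

Lemma bounded_mfunD f g :
  bounded_mfun f -> bounded_mfun g -> bounded_mfun (fun w => f w + g w).
Proof.
move=> [mf [M fM]] [mg [N gN]]; split; first exact: measurable_funD.
exists (M + N) => w; apply: le_trans (ler_normD _ _) _; exact: lerD.
Qed.

Lemma bounded_mfunM f g :
  bounded_mfun f -> bounded_mfun g -> bounded_mfun (fun w => f w * g w).
Proof.
move=> [mf [M fM]] [mg [N gN]]; split; first exact: measurable_funM.
by exists (M * N) => w; rewrite normrM ler_pM.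
Qed.

Lemma bounded_mfunX f k : bounded_mfun f -> bounded_mfun (fun w => f w ^+ k).
Proof.
move=> bf; elim: k => [|k IHk]; first exact: bounded_mfun_cst.
by under eq_fun do rewrite exprS; exact: bounded_mfunM.
Qed.

Lemma bounded_mfun_sum (I : Type) (s : seq I) (Q : pred I) (F : I -> T -> R) :
  (forall i, bounded_mfun (F i)) ->
  bounded_mfun (fun w => \sum_(i <- s | Q i) F i w).
Proof.
move=> bF; elim: s => [|i s IHs].
  by under eq_fun do rewrite big_nil; exact: bounded_mfun_cst.
under eq_fun do rewrite big_cons.
by case: (Q i) => //; exact: bounded_mfunD.
Qed.

Lemma bounded_mfun_prod (I : Type) (s : seq I) (Q : pred I) (F : I -> T -> R) :
  (forall i, bounded_mfun (F i)) ->
  bounded_mfun (fun w => \prod_(i <- s | Q i) F i w).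
Proof.
move=> bF; elim: s => [|i s IHs].
  by under eq_fun do rewrite big_nil; exact: bounded_mfun_cst.
under eq_fun do rewrite big_cons.
by case: (Q i) => //; exact: bounded_mfunM.
Qed.

Lemma bounded_mfun_indic (A : set T) :
  measurable A -> bounded_mfun (fun w => \1_A w).
Proof.
move=> mA; split; first exact: measurable_indic.
by exists 1 => w; rewrite indicE; case: (_ \in _); rewrite ?normr1 ?normr0.
Qed.

Lemma bounded_mfun_integrable f :
  bounded_mfun f -> P.-integrable [set: T] (EFin \o f).
Proof.
move=> [mf [M fM]]; apply: measurable_bounded_integrable => //.
  by rewrite (le_lt_trans (probability_le1 _ _)) ?ltry.
exists M; split; first exact: num_real.
by move=> x Mx w _; exact: le_trans (fM w) (ltW Mx).
Qed.

Lemma meanD f g : bounded_mfun f -> bounded_mfun g ->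
  mean (fun w => f w + g w) = mean f + mean g.
Proof. by move=> bf bg; apply: RintegralD => //; exact: bounded_mfun_integrable. Qed.

Lemma meanZ c f : bounded_mfun f -> mean (fun w => c * f w) = c * mean f.
Proof. by move=> bf; apply: RintegralZl => //; exact: bounded_mfun_integrable. Qed.

Lemma mean0 : mean (fun=> 0) = 0.
Proof. by rewrite /mean Rintegral_cst // mul0r. Qed.

Lemma mean_sum (I : Type) (s : seq I) (Q : pred I) (F : I -> T -> R) :
  (forall i, bounded_mfun (F i)) ->
  mean (fun w => \sum_(i <- s | Q i) F i w) = \sum_(i <- s | Q i) mean (F i).
Proof.
move=> bF; elim: s => [|i s IHs].
  by under eq_fun do rewrite big_nil; rewrite big_nil mean0.
rewrite big_cons; under eq_fun do rewrite big_cons.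
case: (Q i) => //; rewrite meanD ?IHs //; exact: bounded_mfun_sum.
Qed.

Lemma mean_le f g : bounded_mfun f -> bounded_mfun g ->
  (forall w, f w <= g w) -> mean f <= mean g.
Proof.
move=> bf bg fg; apply: le_Rintegral => //; exact: bounded_mfun_integrable.
Qed.

Lemma mean_indic (A : set T) : measurable A -> mean (fun w => \1_A w) = fine (P A).
Proof. by move=> mA; rewrite /mean /Rintegral integral_indic // setIT. Qed.

(* The integral of a nonnegative function is a supremum over the simple functions
   below it, so a measurable upper bound on the depth suffices: the depth itself
   is never shown to be measurable. *)
Lemma expectation_le_mean f g : (forall w, 0 <= f w) -> bounded_mfun g ->
  (forall w, f w <= g w) -> ('E_P[f] <= (mean g)%:E)%E.
Proof.
move=> f0 bg fg; rewrite unlock /mean /Rintegral fineK; last first.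
  exact/integrable_fin_num/bounded_mfun_integrable.
have g0 w : (0 <= (g w)%:E)%E by rewrite lee_fin (le_trans (f0 w)).
rewrite !ge0_integralTE //.
apply: ereal_sup_le => _ /= [h hf <-]; exists h => // w.
by apply: le_trans (hf w) _; rewrite lee_fin.
Qed.

End BoundedMeasurable.

(** * Disjointness of finite sets *)

Lemma disjoint_setU1 (V : finType) (x : V) (A B : {set V}) :
  ([disjoint x |: A & B]%B : bool) = (x \notin B) && [disjoint A & B]%B.
Proof.
rewrite (@eq_disjoint _ _ (predU1 x (mem A))) ?disjointU1 // => y.
by rewrite !inE.
Qed.

Lemma disjoints0 (V : finType) (A : {set V}) : ([disjoint finset.set0 & A]%B : bool).
Proof. by rewrite (@eq_disjoint0 _ (mem finset.set0)) // => y; rewrite inE. Qed.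

Lemma disjointsU (V : finType) (A B C : {set V}) :
  ([disjoint A & (B :|: C)%SET]%B : bool) = [disjoint A & B]%B && [disjoint A & C]%B.
Proof.
by rewrite disjoint_sym (@eq_disjoint _ _ [predU B & C]) ?disjointU 1?disjoint_sym
  1?[X in _ && X]disjoint_sym // => y; rewrite !inE.
Qed.

(** * Second moments under limited independence *)

Section LimitedIndependence.
Context {d : measure_display} {T : measurableType d} {R : realType}.
Variables (P : probability T R) (n : nat) (I : 'I_n -> T -> R) (p : R).
Hypothesis bI : forall i, bounded_mfun (I i).
Hypothesis idemI : forall i w, I i w * I i w = I i w.

(* [W] is uncorrelated with every product of at most [r] of the indicators [I k],
   [k] outside [J]. *)
Definition free_outside (W : T -> R) (J : {set 'I_n}) (r : nat) : Prop :=
  forall K : {set 'I_n}, [disjoint K & J]%B -> (#|K| <= r)%N ->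
  mean P (fun w => W w * \prod_(k in K) I k w) = mean P W * p ^+ #|K|.

(** The centred count of the indicators in [A], when each has mean [p]. *)
Definition dev (A : {set 'I_n}) (w : T) : R := \sum_(i in A) (I i w - p).

Lemma bounded_mfun_dev A : bounded_mfun (dev A).
Proof.
by apply: bounded_mfun_sum => i; apply: bounded_mfunD => //; exact: bounded_mfun_cst.
Qed.

(** When the square is expanded, off-diagonal terms cancel and each diagonal term gives
    [p * (1 - p)]. A term involves at most two indices besides [K], hence the order [r.+2]. Keeping
    the product over [K] shows that [W * dev A ^+ 2] is again free, so the computation can be
    iterated. *)
Lemma mean_mul_dev2 W (J A K : {set 'I_n}) r : bounded_mfun W -> free_outside W J r.+2 ->
  [disjoint A & J]%B -> [disjoint K & J]%B -> [disjoint K & A]%B -> (#|K| <= r)%N ->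
  mean P (fun w => W w * dev A w ^+ 2 * \prod_(k in K) I k w)
  = mean P W * (#|A|%:R * (p * (1 - p))) * p ^+ #|K|.
Proof.
move=> bW free dAJ dKJ dKA Kr.
pose V w := W w * \prod_(k in K) I k w.
have bV : bounded_mfun V by apply: bounded_mfunM => //; exact: bounded_mfun_prod.
have V0 : mean P V = mean P W * p ^+ #|K| by apply: free => //; lia.
have V1 i : i \in A -> mean P (fun w => V w * I i w) = mean P W * p ^+ #|K| * p.
  move=> iA; have iK : i \notin K by apply/negP => /(disjointFr dKA); rewrite iA.
  have := free (i |: K)%SET; rewrite cardsU1 iK add1n exprSr mulrA => <-.
  - congr mean; apply/funext => w; rewrite big_setU1 //= /V.
    by rewrite -mulrA [_ * I i w]mulrC.
  - by rewrite disjoint_setU1 dKJ andbT (disjointFr dAJ).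
  - by lia.
have V2 i j : i \in A -> j \in A -> i != j ->
    mean P (fun w => V w * (I i w * I j w)) = mean P W * p ^+ #|K| * p ^+ 2.
  move=> iA jA ij.
  have iK : i \notin K by apply/negP => /(disjointFr dKA); rewrite iA.
  have jK : j \notin K by apply/negP => /(disjointFr dKA); rewrite jA.
  have ijK : i \notin (j |: K)%SET by rewrite !inE negb_or ij.
  have := free (i |: (j |: K))%SET; rewrite cardsU1 ijK cardsU1 jK !add1n.
  rewrite -mulrA -exprD addn2 => <-.
  - congr mean; apply/funext => w; rewrite big_setU1 //= big_setU1 //= /V.
    by rewrite -mulrA [_ * (I i w * _)]mulrC !mulrA.
  - by rewrite !disjoint_setU1 dKJ andbT !(disjointFr dAJ).
  - by lia.
have bVI i : bounded_mfun (fun w => V w * I i w) by exact: bounded_mfunM.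
have bVII i j : bounded_mfun (fun w => V w * (I i w * I j w)).
  by apply: bounded_mfunM => //; exact: bounded_mfunM.
(* Off the diagonal the factor is [p ^+ 2 - 2 * p ^+ 2 + p ^+ 2 = 0]; on it [idemI] replaces the
   square by the indicator and leaves [p - p ^+ 2]. *)
have cross i j : i \in A -> j \in A ->
    mean P (fun w => V w * ((I i w - p) * (I j w - p))) =
    if i == j then mean P W * p ^+ #|K| * (p * (1 - p)) else 0.
  move=> iA jA.
  have -> : (fun w => V w * ((I i w - p) * (I j w - p))) =
      (fun w => V w * (I i w * I j w) + (- p) * (V w * I i w)
                + (- p) * (V w * I j w) + p ^+ 2 * V w).
    by apply/funext => w; ring.
  have bZ c f : bounded_mfun f -> bounded_mfun (fun w => c * f w).
    by move=> bf; apply: bounded_mfunM => //; exact: bounded_mfun_cst.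
  rewrite !meanD ?meanZ //; do ?[by [] | exact: bZ | apply: bounded_mfunD].
  rewrite V0 !V1 //; case: eqVneq => [->|ij]; last by rewrite V2 //; ring.
  by under eq_fun do rewrite idemI; rewrite V1 //; ring.
have bcross : forall k l,
    bounded_mfun (fun w => V w * ((I k w - p) * (I l w - p))).
  by move=> k l; do ?apply: bounded_mfunM => //; apply: bounded_mfunD => //;
    exact: bounded_mfun_cst.
have -> : (fun w => W w * dev A w ^+ 2 * \prod_(k in K) I k w) =
    (fun w => \sum_(i in A) \sum_(j in A) V w * ((I i w - p) * (I j w - p))).
  apply/funext => w; rewrite expr2 /dev mulrAC -/(V w) big_distrlr /= mulr_sumr.
  by apply: eq_bigr => i _; rewrite mulr_sumr.
rewrite mean_sum; last by move=> k; exact: bounded_mfun_sum.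
have -> : mean P W * (#|A|%:R * (p * (1 - p))) * p ^+ #|K| =
   \sum_(i in A) mean P W * p ^+ #|K| * (p * (1 - p)).
  by rewrite sumr_const -mulr_natl; ring.
apply: eq_bigr => i iA; rewrite mean_sum //.
transitivity (\sum_(j in A)
    if i == j then mean P W * p ^+ #|K| * (p * (1 - p)) else 0).
  by apply: eq_bigr => j jA; exact: cross.
rewrite -big_mkcondr /= (big_pred1 i) // => j /=.
by rewrite eq_sym; case: eqP => [->|]; rewrite ?iA ?andbF.
Qed.

(** Each squared deviation uses up two of the four free indices: after [A] has been absorbed into
    the weight, order 2 is left outside [J :|: A], just enough for [B]. *)
Lemma mean_dev2_dev2 W (J A B : {set 'I_n}) :
  bounded_mfun W -> free_outside W J 4 ->
  [disjoint A & J]%B -> [disjoint B & J]%B -> [disjoint A & B]%B ->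
  mean P (fun w => W w * dev A w ^+ 2 * dev B w ^+ 2)
  = mean P W * (#|A|%:R * (p * (1 - p))) * (#|B|%:R * (p * (1 - p))).
Proof.
move=> bW free dAJ dBJ dAB.
have bWA : bounded_mfun (fun w => W w * dev A w ^+ 2).
  by apply: bounded_mfunM => //; apply/bounded_mfunX/bounded_mfun_dev.
have eWA : mean P (fun w => W w * dev A w ^+ 2)
    = mean P W * (#|A|%:R * (p * (1 - p))).
  have := @mean_mul_dev2 W J A finset.set0 2 bW free dAJ.
  rewrite !disjoints0 cards0 expr0 mulr1 => <- //.
  by congr mean; apply/funext => w; rewrite big_set0 mulr1.
have freeA : free_outside (fun w => W w * dev A w ^+ 2) (J :|: A)%SET 2.
  move=> K; rewrite disjointsU => /andP[dKJ dKA] K2.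
  rewrite eWA; exact: (@mean_mul_dev2 W J A K 2).
have := @mean_mul_dev2 _ _ B finset.set0 0 bWA freeA.
rewrite disjointsU dBJ disjoint_sym dAB !disjoints0 cards0 expr0 mulr1 eWA => <- //.
by congr mean; apply/funext => w; rewrite big_set0 mulr1.
Qed.
End LimitedIndependence.

(** * Records under limited independence *)

Lemma prod_indic (T : Type) (R : realType) (V : finType) (J : {set V})
    (A : V -> set T) w :
  \prod_(k in J) \1_(A k) w = \1_(\bigcap_(k in [set` J]) A k) w :> R.
Proof.
have [wA|/existsNP[k /not_implyP[kJ wA]]] := pselect (forall k, k \in J -> A k w).
  rewrite big1 => [|k kJ]; rewrite indicE mem_set //; exact: wA.
rewrite (bigD1 k) //= !indicE memNset // mul0r memNset //.
by move=> /(_ k kJ).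
Qed.

(** * The law of the uniform offsets *)

Section UniformKeys.
Context {d : measure_display} {T : measurableType d} {R : realType}.
Variables (P : probability T R) (n : nat) (delta : 'I_n -> {RV P >-> R}).
Hypothesis unif : forall x, uniform01 (delta x).

Lemma measurable_delta x (B : set R) : measurable B -> measurable (delta x @^-1` B).
Proof. by move=> mB; rewrite -[X in measurable X]setTI; exact: measurable_funP. Qed.

Lemma prob_delta x (B : set R) : measurable B ->
  P (delta x @^-1` B) = (@lebesgue_measure R) (B `&` `[0%R, 1%R]).
Proof.
move=> mB; have := unif x mB; rewrite /distribution /pushforward => ->.
rewrite /uniform_prob integral_uniform_pdf.
rewrite (eq_integral (fun=> 1%E)); last first.
  by move=> r; rewrite inE /= in_itv /= /uniform_pdf => -[_ ->]; rewrite subr0 invr1.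
by rewrite integral_cst ?mul1e //; exact: measurableI.
Qed.

Lemma prob_delta_co x (a b : R) : 0 <= a -> a <= b -> b <= 1 ->
  fine (P (delta x @^-1` `[a, b[)) = b - a.
Proof.
move=> a0 ab b1; rewrite prob_delta // setIidl; last first.
  move=> r /=; rewrite !in_itv /= => /andP[ar rb].
  by rewrite (le_trans a0 ar) (le_trans (ltW rb)).
rewrite lebesgue_measure_itv /= lte_fin; case: ltP => // ba.
by have/eqP -> : a == b by [rewrite eq_le ab]; rewrite subrr.
Qed.

Lemma prob_delta_cy x (a : R) : 0 <= a <= 1 ->
  fine (P (delta x @^-1` `[a, +oo[)) = 1 - a.
Proof.
move=> /andP[a0 a1]; rewrite prob_delta //.
have -> : `[a, +oo[%classic `&` `[0%R, 1%R]%classic = `[a, 1%R]%classic.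
  apply/seteqP; split => r /=; rewrite !in_itv /= andbT.
    by move=> [-> /andP[]].
  by move=> /andP[ar r1]; rewrite ar r1 (le_trans a0 ar).
rewrite lebesgue_measure_itv /= lte_fin; case: ltP => // ba.
by have/eqP -> : a == 1 by [rewrite eq_le a1]; rewrite subrr.
Qed.

Lemma prob_delta_yo x : P (delta x @^-1` `]-oo, 0%R[) = 0%E.
Proof.
rewrite prob_delta // [X in lebesgue_measure X](_ : _ = set0) ?measure0 //.
apply/seteqP; split => r //=; rewrite !in_itv /= => -[r0 /andP[]].
by rewrite leNgt r0.
Qed.

Lemma mean_prod_indic k (J : {set 'I_n}) (B : 'I_n -> set R) :
  kwise_independent k delta -> (#|J| <= k)%N -> (forall i, measurable (B i)) ->
  mean P (fun w => \prod_(i in J) \1_(delta i @^-1` B i) w)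
  = \prod_(i in J) fine (P (delta i @^-1` B i)).
Proof.
move=> ind Jk mB; under eq_fun do rewrite prod_indic.
rewrite mean_indic; last first.
  by apply: fin_bigcap_measurable => // i _; exact: measurable_delta.
rewrite ind // -[RHS]/(fine (_%:E)) (big_morph EFin EFinM erefl); congr fine.
apply: eq_bigr => i _; rewrite fineK // fin_num_measure //.
exact: measurable_delta.
Qed.

End UniformKeys.

(** * The probability of beating a set of competitors *)

Section Record.
Context {d : measure_display} {T : measurableType d} {R : realType}.
Variables (P : probability T R) (n : nat) (delta : 'I_n -> {RV P >-> R}).
Hypothesis unif : forall x, uniform01 (delta x).
Hypothesis indep : kwise_independent 5 delta.

(** The indicator for [y] takes one of the five independent indices and leaves products of four
    others. *)
Lemma free_outside_indic y (B V : set R) (b p : R) :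
  measurable B -> measurable V ->
  fine (P (delta y @^-1` B)) = b ->
  (forall i, fine (P (delta i @^-1` V)) = p) ->
  mean P (fun w => \1_(delta y @^-1` B) w) = b /\
  free_outside P (fun i w => \1_(delta i @^-1` V) w) p
    (fun w => \1_(delta y @^-1` B) w) [set y]%SET 4.
Proof.
move=> mB mV Bb Vp.
have b1 : mean P (fun w => \1_(delta y @^-1` B) w) = b.
  by rewrite mean_indic //; exact: measurable_delta.
split=> // K; rewrite disjoint_sym disjoints1 => yK K4.
have := @mean_prod_indic _ _ _ _ _ delta 5 (y |: K)%SET
  (fun k => if k == y then B else V) indep.
have kE k : k \in K -> (k == y) = false.
  by move=> kK; apply: contraNF yK => /eqP <-.
rewrite big_setU1 //= eqxx Bb.
rewrite (eq_bigr (fun=> p)) => [|k kK]; last by rewrite kE.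
rewrite prodr_const b1 => <-.
- congr mean; apply/funext => w; rewrite big_setU1 //= eqxx; congr (_ * _).
  by apply: eq_bigr => k kK; rewrite kE.
- by rewrite cardsU1 yK; lia.
- by move=> k; case: ifP.
Qed.

Lemma disjoint_halves (S : {set 'I_n}) h : (h.*2 <= #|S|)%N ->
  exists A B : {set 'I_n},
    [/\ A \subset S, B \subset S, [disjoint A & B]%B, #|A| = h & #|B| = h].
Proof.
move=> hS; have uS := enum_uniq S; have sS : size (enum S) = #|S| by rewrite cardE.
exists [set x in take h (enum S)]%SET, [set x in take h (drop h (enum S))]%SET.
split.
- by apply/fintype.subsetP => x; rewrite inE => /mem_take; rewrite mem_enum.
- by apply/fintype.subsetP => x; rewrite inE => /mem_take/mem_drop; rewrite mem_enum.
- rewrite -setI_eq0; apply/eqP/setP => x; rewrite !inE.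
  apply/negP => /andP[xt /mem_take xd].
  move: uS; rewrite -(cat_take_drop h (enum S)) cat_uniq => /and3P[_ /hasPn/(_ _ xd)].
  by rewrite xt.
- rewrite cardsE; have /card_uniqP -> : uniq (take h (enum S)) by exact: take_uniq.
  by rewrite size_takel // sS; lia.
- rewrite cardsE; have /card_uniqP -> : uniq (take h (drop h (enum S))).
    by rewrite take_uniq // drop_uniq.
  by rewrite size_takel // size_drop sS; lia.
Qed.

(** Bins are numbered downwards from 1. For [s <= h], [top_part h s] is everything above bin [s] and
    has probability [s / h], the centring used in [top_dev]. *)
Definition top_bin (h s : nat) : set R := `[1 - s.+1%:R / h%:R, 1 - s%:R / h%:R[.
Definition top_part (h s : nat) : set R := `[1 - s%:R / h%:R, +oo[.

Definition top_dev (h s : nat) : {set 'I_n} -> T -> R :=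
  dev (fun i w => \1_(delta i @^-1` top_part h s) w) (s%:R / h%:R).

(** The bin has probability [1 / h], and the count in each half has variance
    [h * (s / h) * (1 - s / h) <= s]; independence multiplies the three. *)
Lemma mean_top_bin y (A B : {set 'I_n}) h s :
  y \notin A -> y \notin B -> [disjoint A & B]%B -> #|A| = h -> #|B| = h ->
  (0 < s < h)%N ->
  mean P (fun w => \1_(delta y @^-1` top_bin h s) w * top_dev h s A w ^+ 2
                   * top_dev h s B w ^+ 2)
  <= h%:R^-1 * s%:R ^+ 2.
Proof.
move=> yA yB dAB cA cB /andP[s0 sh].
have h0 : 0 < h%:R :> R by rewrite ltr0n; lia.
have s0' : 0 < s%:R :> R by rewrite ltr0n.
have sh' : s%:R / h%:R <= 1 :> R by rewrite ler_pdivrMr // mul1r ler_nat; lia.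
have sh1 : s.+1%:R / h%:R <= 1 :> R by rewrite ler_pdivrMr // mul1r ler_nat.
have shge0 : 0 <= s%:R / h%:R :> R by rewrite divr_ge0 ?ler0n.
have mB : measurable (top_bin h s) by exact: measurable_itv.
have mV : measurable (top_part h s) by exact: measurable_itv.
have [b1 free] : mean P (fun w => \1_(delta y @^-1` top_bin h s) w) = h%:R^-1 /\
  free_outside P (fun i w => \1_(delta i @^-1` top_part h s) w) (s%:R / h%:R)
    (fun w => \1_(delta y @^-1` top_bin h s) w) [set y]%SET 4.
  apply: free_outside_indic => //.
    have eS : s.+1%:R / h%:R = s%:R / h%:R + h%:R^-1 :> R.
      by rewrite -natr1 mulrDl mul1r.
    have hV : 0 < h%:R^-1 :> R by rewrite invr_gt0.
    by rewrite prob_delta_co ?eS //; lra.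
  move=> i; rewrite prob_delta_cy //; first by ring.
  by apply/andP; split; lra.
have bV i : bounded_mfun (fun w => \1_(delta i @^-1` top_part h s) w : R).
  by apply: bounded_mfun_indic; exact: measurable_delta.
rewrite (@mean_dev2_dev2 _ _ _ P n _ _ bV _ _ [set y]%SET) //.
- rewrite b1 cA cB -mulrA ler_pM2l ?invr_gt0 // expr2.
  have -> : h%:R * (s%:R / h%:R * (1 - s%:R / h%:R)) = s%:R * (1 - s%:R / h%:R) :> R.
    by field; rewrite gt_eqF.
  have le1 : s%:R * (1 - s%:R / h%:R) <= s%:R :> R.
    by rewrite ler_piMr ?ler0n //; lra.
  by apply: ler_pM => //; rewrite mulr_ge0 ?ler0n // subr_ge0.
- by move=> i w; rewrite indicE; case: (_ \in _); rewrite ?mulr1 ?mulr0.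
- by apply: bounded_mfun_indic; exact: measurable_delta.
- by rewrite disjoint_sym disjoints1.
- by rewrite disjoint_sym disjoints1.
Qed.

Definition record (y : 'I_n) (S : {set 'I_n}) : set T :=
  [set w | forall i, i \in S -> delta i w <= delta y w].

Lemma measurable_record y S : measurable (record y S).
Proof.
have -> : record y S = \bigcap_(i in [set` S]) [set w | delta i w <= delta y w].
  by apply/seteqP; split => w.
apply: fin_bigcap_measurable => // i _.
rewrite -[X in measurable X]setTI.
have mle : measurable_fun [set: T] (fun w => delta i w <= delta y w).
  by apply: measurable_fun_ler; exact: measurable_funP.
exact: (mle measurableT [set true]).
Qed.

Lemma sum_telescope_le1 h :
  \sum_(s < h) (s.+1%:R^-1 - s.+2%:R^-1 : R) <= 1.
Proof.
have -> : \sum_(s < h) (s.+1%:R^-1 - s.+2%:R^-1 : R) = 1 - h.+1%:R^-1.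
  elim: h => [|h IHh]; first by rewrite big_ord0 invr1 subrr.
  by rewrite big_ord_recr /= IHh; ring.
by rewrite lerBlDr lerDl invr_ge0 ler0n.
Qed.

Lemma mem_top_bin (h : nat) (r : R) : (0 < h)%N -> 0 <= r < 1 ->
  exists s : 'I_h, top_bin h s r.
Proof.
move=> h0 /andP[r0 r1]; have hR : 0 < h%:R :> R by rewrite ltr0n.
have /andP[t1 t2] := truncn_itv (mulr_ge0 r0 (ltW hR)).
set t := Num.truncn _ in t1 t2.
have th : (t < h)%N.
  by rewrite -(ltr_nat R) (le_lt_trans t1) // gtr_pMl.
(* [t] numbers the bins upwards from 0, so it is reflected to [h.-1 - t]. *)
have sh : (h.-1 - t < h)%N by lia.
exists (Ordinal sh); rewrite /top_bin /= in_itv /=.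
have -> : 1 - (h.-1 - t).+1%:R / h%:R = t%:R / h%:R :> R.
  have -> : (h.-1 - t).+1%:R = h%:R - t%:R :> R.
    by rewrite -natrB ?(ltnW th) //; apply: congr1; lia.
  by field; rewrite gt_eqF.
have -> : 1 - (h.-1 - t)%:R / h%:R = t.+1%:R / h%:R :> R.
  have -> : (h.-1 - t)%:R = h%:R - t.+1%:R :> R by rewrite -natrB //; apply: congr1; lia.
  by field; rewrite gt_eqF.
by rewrite ler_pdivrMr // ltr_pdivlMr // t1.
Qed.

(* The record value lies in the [s]-th bin below 1 only if both halves of the
   competitors avoid the [s] bins above it; both centred counts then equal
   [- s], so that the product of their squares is at least [s ^ 4]. *)
Lemma prob_record_le y (S : {set 'I_n}) : y \notin S ->
  fine (P (record y S)) <= 24 / #|S|.+1%:R.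
Proof.
(* Below two competitors the halves would be empty, but then the bound exceeds 1. *)
move=> yS; have [S2|S2] := ltnP #|S| 2.
  apply: (@le_trans _ _ 1).
    rewrite -lee_fin fineK ?probability_le1 ?fin_num_measure //;
      exact: measurable_record.
  rewrite ler_pdivlMr ?ltr0n // mul1r -[24]/(24%:R) ler_nat; lia.
pose h := #|S|./2; have h0 : (0 < h)%N by rewrite /h; lia.
have hR : 0 < h%:R :> R by rewrite ltr0n.
have [A [B [AS BS dAB cA cB]]] : exists A B : {set 'I_n},
    [/\ A \subset S, B \subset S, [disjoint A & B]%B, #|A| = h & #|B| = h].
  by apply: disjoint_halves; rewrite /h; lia.
have yA : y \notin A by apply: contra yS; exact: (fintype.subsetP AS).
have yB : y \notin B by apply: contra yS; exact: (fintype.subsetP BS).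
pose D s w := \1_(delta y @^-1` top_bin h s) w * top_dev h s A w ^+ 2
                   * top_dev h s B w ^+ 2.
(* Markov's inequality for the product of squares, with threshold [s ^ 4]. At [s = 0] it gives
   nothing, and the indicator of the bin is kept. *)
pose G (s : nat) w : R := if s == 0%N then \1_(delta y @^-1` top_bin h s) w
  else s%:R ^- 4 * D s w.
have bbin s : bounded_mfun (fun w => \1_(delta y @^-1` top_bin h s) w : R).
  by apply: bounded_mfun_indic; apply: measurable_delta; exact: measurable_itv.
have bdev s C : bounded_mfun (fun w => top_dev h s C w ^+ 2).
  apply: bounded_mfunX; apply: bounded_mfun_dev => i.
  by apply: bounded_mfun_indic; apply: measurable_delta; exact: measurable_itv.
have bD s : bounded_mfun (D s) by apply: bounded_mfunM => //; exact: bounded_mfunM.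
have bG s : bounded_mfun (G s).
  rewrite /G; case: eqP => _ //; apply: bounded_mfunM => //; exact: bounded_mfun_cst.
have D0 s w : 0 <= D s w.
  by rewrite /D mulr_ge0 ?sqr_ge0 // mulr_ge0 ?sqr_ge0.
have G0 s w : 0 <= G s w.
  by rewrite /G; case: eqP => _; rewrite ?indicE ?ler0n //
    mulr_ge0 ?invr_ge0 ?exprn_ge0 ?ler0n.
(* Replaces [1 / s ^ 2] by a telescoping term: [(s + 1) * (s + 2) <= 6 * s ^ 2] for [s >= 1], with
   equality at [s = 1]. *)
have meanG (s : 'I_h) : mean P (G s) <= h%:R^-1 * 6 * (s.+1%:R^-1 - s.+2%:R^-1).
  have [s0|s0] := posnP s.
    rewrite /G s0 eqxx mean_indic; last by apply: measurable_delta; exact: measurable_itv.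
    have hV1 : h%:R^-1 <= 1 :> R by rewrite invf_le1 // ler1n.
    have hV : 0 < h%:R^-1 :> R by rewrite invr_gt0.
    rewrite /top_bin mul0r subr0 mul1r prob_delta_co //; lra.
  have sR : 0 < s%:R :> R by rewrite ltr0n.
  rewrite /G gtn_eqF // meanZ //.
  apply: (@le_trans _ _ (s%:R ^- 4 * (h%:R^-1 * s%:R ^+ 2))).
    rewrite ler_pM2l ?invr_gt0 ?exprn_gt0 //; apply: mean_top_bin => //.
    by rewrite s0 ltn_ord.
  have s1 : 1 <= s%:R :> R by rewrite ler1n.
  have -> : s%:R ^- 4 * (h%:R^-1 * s%:R ^+ 2) = h%:R^-1 * s%:R ^- 2 :> R.
    by field; rewrite !gt_eqF.
  have e1 : s.+1%:R = s%:R + 1 :> R by rewrite natr1.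
  have e2 : s.+2%:R = s%:R + 1 + 1 :> R by rewrite !natr1.
  rewrite -mulrA ler_pM2l ?invr_gt0 // e1 e2.
  have -> : 6 * ((s%:R + 1)^-1 - (s%:R + 1 + 1)^-1) = 6 / ((s%:R + 1) * (s%:R + 2)) :> R.
    by field; rewrite !gt_eqF //; lra.
  rewrite ler_pdivlMr ?mulr_gt0 //; [|lra..].
  rewrite mulrC ler_pdivrMr ?exprn_gt0 //; nra.
(* The first two terms catch offsets outside [[0, 1)], which form null events. *)
have cover w : \1_(record y S) w <= \1_(delta y @^-1` `]-oo, 0%R[) w
    + \1_(delta y @^-1` `[1%R, +oo[) w + \sum_(s < h) G s w.
  have sG0 : 0 <= \sum_(s < h) G s w by apply: sumr_ge0.
  have i0 (E : set T) : 0 <= \1_E w :> R by rewrite indicE ler0n.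
  have [wR|wR] := pselect (record y S w); last first.
    by rewrite indicE memNset // !addr_ge0.
  rewrite [X in X <= _]indicE mem_set //.
  have [y0|y0] := ltP (delta y w) 0.
    rewrite [X in _ <= X + _ + _]indicE mem_set /=; last by rewrite in_itv.
    by rewrite -addrA lerDl addr_ge0.
  have [y1|y1] := leP 1 (delta y w).
    rewrite [X in _ <= _ + X + _]indicE mem_set /=; last by rewrite in_itv /= y1.
    by rewrite [X in X + _]addrC -addrA lerDl addr_ge0.
  have [s ys] : exists s : 'I_h, top_bin h s (delta y w).
    by apply: mem_top_bin => //; rewrite y0.
  apply: ler_wpDl; first exact: addr_ge0.
  rewrite (bigD1 s) //=; apply: ler_wpDr; first by apply: sumr_ge0.
  have yin : \1_(delta y @^-1` top_bin h s) w = 1 :> R by rewrite indicE mem_set.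
  rewrite /G yin; case: eqP => // /eqP s0; rewrite -lt0n in s0.
  have devE (C : {set 'I_n}) : C \subset S -> #|C| = h -> top_dev h s C w = - s%:R.
    move=> /fintype.subsetP CS cC; rewrite /top_dev /dev.
    rewrite (eq_bigr (fun=> - (s%:R / h%:R))) => [|i /CS iS].
      by rewrite sumr_const cC -mulr_natl; field; rewrite gt_eqF.
    rewrite indicE memNset ?sub0r // /top_part /= in_itv /= andbT => iV.
    move: ys; rewrite /top_bin /= in_itv /= => /andP[_].
    by rewrite ltNge (le_trans iV) // wR.
  rewrite /D yin !devE //.
  have sR : s%:R != 0 :> R by rewrite pnatr_eq0 -lt0n.
  have -> : s%:R ^- 4 * (1 * (- s%:R) ^+ 2 * (- s%:R) ^+ 2) = 1 :> R by field.
  by [].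
have m1 : measurable (delta y @^-1` `]-oo, 0%R[).
  by apply: measurable_delta; exact: measurable_itv.
have m2 : measurable (delta y @^-1` `[1%R, +oo[).
  by apply: measurable_delta; exact: measurable_itv.
rewrite -mean_indic; last exact: measurable_record.
apply: le_trans (mean_le P _ _ cover) _.
- by apply: bounded_mfun_indic; exact: measurable_record.
- apply: bounded_mfunD; last exact: bounded_mfun_sum.
  by apply: bounded_mfunD; exact: bounded_mfun_indic.
rewrite meanD; last 2 first.
- by apply: bounded_mfunD; exact: bounded_mfun_indic.
- exact: bounded_mfun_sum.
rewrite meanD; [|exact: bounded_mfun_indic..].
rewrite !mean_indic // prob_delta_yo // prob_delta_cy ?ler01 ?lexx // subrr !add0r.
rewrite mean_sum //; apply: (@le_trans _ _ (h%:R^-1 * 6)).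
  apply: (@le_trans _ _ (\sum_(s < h) h%:R^-1 * 6 * (s.+1%:R^-1 - s.+2%:R^-1))).
    by apply: ler_sum => s _; exact: meanG.
  rewrite -mulr_sumr ler_piMr ?mulr_ge0 ?invr_ge0 ?ler0n //; exact: sum_telescope_le1.
rewrite ler_pdivlMr ?ltr0n // -mulrA mulrC ler_pdivrMr //.
(* Rounding in [h] costs a factor of at most 4, which turns [6 / h] into [24 / #|S|.+1]. *)
have : (#|S|.+1 <= 4 * h)%N by rewrite /h; lia.
rewrite -(ler_nat R) natrM; lra.
Qed.

End Record.

(** * Tiers of the keys *)

(** The rank is injective on [S] with values below [#|S|], so the ranks are a permutation of these
    numbers. The order is abstract because the keys to the left of [x] are ranked by the reversed
    order. *)
Lemma sum_rank (R : realType) (V : finType) (lt : rel V) (S : {set V})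
    (f : nat -> R) :
  transitive lt -> irreflexive lt -> (forall y z, y != z -> lt y z || lt z y) ->
  \sum_(y in S) f #|[set z in S | lt z y]%SET| = \sum_(r < #|S|) f r.
Proof.
move=> lt_trans lt_irr lt_total.
pose rank y := #|[set z in S | lt z y]%SET|.
have rank_lt y z : y \in S -> lt y z -> (rank y < rank z)%N.
  move=> yS yz; apply: proper_card; apply/properP; split.
    by apply/fintype.subsetP => u; rewrite !inE => /andP[-> /lt_trans]; exact.
  by exists y; rewrite !inE yS ?yz ?lt_irr.
have rank_inj : {in S &, injective rank}.
  move=> y z yS zS e; apply/eqP/negPn/negP => /lt_total/orP[] lyz.
    by have := rank_lt _ _ yS lyz; rewrite e ltnn.
  by have := rank_lt _ _ zS lyz; rewrite e ltnn.
have rank_bound y : y \in S -> (rank y < #|S|)%N.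
  move=> yS; apply: proper_card; apply/properP; split.
    by apply/fintype.subsetP => u; rewrite !inE => /andP[].
  by exists y; rewrite ?inE ?yS ?lt_irr.
have u : uniq (map rank (enum S)).
  rewrite map_inj_in_uniq ?enum_uniq // => y z; rewrite !mem_enum; exact: rank_inj.
have p : perm_eq (map rank (enum S)) (iota 0 #|S|).
  apply: uniq_perm => //; first exact: iota_uniq.
  have [] // := uniq_min_size u _ _ (s2 := iota 0 #|S|).
    by move=> r /mapP[y]; rewrite mem_enum => yS ->; rewrite mem_iota rank_bound.
  by rewrite size_map size_iota -cardE.
rewrite -(big_mkord xpredT f) /index_iota subn0 -(perm_big _ p) big_map big_enum.
by [].
Qed.

(** Dyadic blocks: the [2 ^ K] terms after the first [2 ^ K] add up to at most 1. *)
Lemma harmonic_le (R : realType) (N K : nat) : (N <= 2 ^ K)%N ->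
  \sum_(r < N) (r.+1%:R^-1 : R) <= K.+1%:R.
Proof.
move=> NK; apply: (@le_trans _ _ (\sum_(r < 2 ^ K) (r.+1%:R^-1 : R))).
  rewrite -!(big_mkord xpredT (fun r => r.+1%:R^-1 : R)).
  rewrite [X in _ <= X](big_cat_nat (leq0n N) NK) /= lerDl.
  by apply: sumr_ge0 => i _; rewrite invr_ge0 ler0n.
elim: K {N NK} => [|K IHK]; first by rewrite expn0 big_ord1 invr1.
have dbl : (2 ^ K.+1 = 2 ^ K + 2 ^ K)%N by rewrite expnS mul2n addnn.
rewrite dbl big_split_ord /= -[K.+2%:R]natr1; apply: lerD => //.
have pos : 0 < (2 ^ K)%:R :> R by rewrite ltr0n expn_gt0.
apply: (@le_trans _ _ (\sum_(r < 2 ^ K) ((2 ^ K)%:R^-1 : R))).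
  apply: ler_sum => r _; rewrite lef_pV2 ?posrE ?ltr0n ?expn_gt0 // ler_nat; lia.
by rewrite sumr_const card_ord -[X in X <= _]mulr_natr mulVf // gt_eqF.
Qed.

(** * The double logarithm *)

Section Level.
Context {R : realType}.
Implicit Types v x : R.

Lemma log2_gtP v k : 0 < v -> (log2 v < k%:R) = (v < 2 ^+ k).
Proof.
move=> v0; have l2 : 0 < ln 2 :> R by rewrite ln_gt0 // ltr1n.
rewrite /log2 ltr_pdivrMr // mulr_natl -lnXn // ltr_ln ?posrE // exprn_gt0.
Qed.

Lemma log2_le0 v : v <= 0 -> log2 v = 0.
Proof. by move=> v0; rewrite /log2 ln0 // mul0r. Qed.

Definition level v : int := Num.floor (log2 (log2 v^-1)).

Lemma level_lt v (k : nat) : 0 < v -> (level v < k%:Z) -> 1 <= v * 2 ^+ (2 ^ k).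
Proof.
move=> v0; rewrite /level floor_lt_int -pmulrn => lk; set L := log2 v^-1 in lk.
have : L < (2 ^ k)%:R.
  (* For [L <= 0] the outer logarithm is a default value, and [L < 2 ^ k] holds by sign. *)
  have [L0|L0] := leP L 0; first by rewrite (le_lt_trans L0) // ltr0n expn_gt0.
  by move: lk; rewrite log2_gtP // natrX.
rewrite /L log2_gtP ?invr_gt0 // => /ltW vk.
by rewrite mulrC -ler_pdivrMr // mul1r.
Qed.

Lemma level_ge v (k : nat) : level v = k -> 2 ^+ k <= at_least1 (log2 v^-1).
Proof.
rewrite /level /at_least1 le_max => vk; set L := log2 v^-1 in vk *.
have kL : k%:R <= log2 L by have := floor_le (log2 L); rewrite vk.
(* Here the default value 0 forces [k = 0], and the 1 in [at_least1] covers [2 ^ 0]. *)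
have [L0|L0] := leP L 0.
  by rewrite log2_le0 // lern0 in kL; rewrite (eqP kL) expr0 lexx.
by rewrite leNgt log2_gtP // -leNgt in kL; rewrite kL orbT.
Qed.

End Level.

(** * Expected depth *)

Section ExpectedDepth.
Context {d : measure_display} {T : measurableType d} {R : realType}.
Variables (P : probability T R) (n : nat) (q : 'I_n -> R).
Variable delta : 'I_n -> {RV P >-> R}.
Hypothesis q_gt0 : forall x, 0 < q x.
Hypothesis q_sum : \sum_(x < n) q x = 1.
Hypothesis unif : forall x, uniform01 (delta x).
Hypothesis indep : kwise_independent 5 delta.

Let pri (w : T) : 'I_n -> R := priority q (fun x => delta x w).

Lemma pri_le w x y : (pri w x <= pri w y) =
  (delta x w - (level (q x))%:~R <= delta y w - (level (q y))%:~R).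
Proof. by rewrite /pri /priority -!/(level _) ![- _ + _]addrC. Qed.

Definition ancestor_event (x y : 'I_n) : set T := [set w | outranks (pri w) x y].

Lemma measurable_ancestor_event x y : measurable (ancestor_event x y).
Proof.
have -> : ancestor_event x y =
    \bigcap_(z in [set` between x y]) [set w | pri w z <= pri w y].
  apply/seteqP; split=> w /=.
    by move=> /forallP h z zb; have /implyP := h z; exact.
  by move=> h; apply/forallP => z; apply/implyP => zb; exact: h.
apply: fin_bigcap_measurable => // z _.
rewrite -[X in measurable X]setTI.
have mp z' : measurable_fun [set: T] (fun w => pri w z').
  by apply: measurable_funD => //; exact: measurable_funP.
have mle : measurable_fun [set: T] (fun w => pri w z <= pri w y).
  exact: measurable_fun_ler.
exact: (mle measurableT [set true]).
Qed.

Definition ancestor_prob (x y : 'I_n) : R := fine (P (ancestor_event x y)).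

Lemma fine_prob_le (A B : set T) : measurable A -> measurable B -> A `<=` B ->
  fine (P A) <= fine (P B).
Proof.
move=> mA mB AB; rewrite fine_le ?fin_num_measure //.
by rewrite le_measure // inE.
Qed.

Lemma ancestor_prob_ge0 x y : 0 <= ancestor_prob x y.
Proof. by rewrite fine_ge0. Qed.

Lemma ancestor_prob_le1 x y : ancestor_prob x y <= 1.
Proof.
have mA := measurable_ancestor_event x y.
by rewrite -lee_fin fineK ?probability_le1 ?fin_num_measure.
Qed.

(** Levels are integers, so they differ by at least 1; [y] can then outrank [x] only if
    [delta x < 0] or [delta y >= 1], a null event. *)
Lemma ancestor_prob_level_gt x y :
  level (q x) < level (q y) -> ancestor_prob x y = 0.
Proof.
move=> lxy; apply/eqP; rewrite eq_le ancestor_prob_ge0 andbT.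
have mA := measurable_ancestor_event x y.
have m1 : measurable (delta x @^-1` `]-oo, 0%R[).
  by apply: measurable_delta; exact: measurable_itv.
have m2 : measurable (delta y @^-1` `[1%R, +oo[).
  by apply: measurable_delta; exact: measurable_itv.
apply: le_trans (fine_prob_le mA (measurableU _ _ m1 m2) _) _.
  move=> w /= /outranks_ler; rewrite pri_le !in_itv /= andbT => h.
  have {}lxy : (level (q x))%:~R + 1 <= (level (q y))%:~R :> R.
    by rewrite -[1]/(1%:~R) -intrD ler_int lezD1.
  by have [|] := ltP (delta x w) 0; [left|right; lra].
apply: (@le_trans _ _ (fine (P (delta x @^-1` `]-oo, 0%R[) +
    P (delta y @^-1` `[1%R, +oo[))%E)).
  rewrite fine_le ?fin_numD ?fin_num_measure //; last exact: measureU2.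
  exact: measurableU.
rewrite fineD ?fin_num_measure // prob_delta_yo // prob_delta_cy ?ler01 ?lexx //.
by rewrite subrr add0r.
Qed.

Definition tier (c : nat) : {set 'I_n} := [set y | level (q y) == c%:Z]%SET.

(** Each key of the tier weighs at least [1 / 2 ^ 2 ^ c.+1], and the weights sum to 1. *)
Lemma card_tier c : (#|tier c| <= 2 ^ (2 ^ c.+1))%N.
Proof.
rewrite -(ler_nat R) natrX -[X in _ <= X]mul1r -[X in _ <= X * _]q_sum mulr_suml.
rewrite -sum1_card natr_sum [X in X <= _]big_mkcond /=; apply: ler_sum => y _.
have qy := q_gt0 y; case: ifPn => [|_]; last by rewrite mulr_ge0 ?exprn_ge0 // ltW.
by rewrite inE => /eqP ly; apply: level_lt; rewrite // ly ltz_nat.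
Qed.

(** Equal levels cancel in the comparison of priorities, so an outranking [y] is a record against
    the tier members between [x] and [y]. Summing the record bound over ranks gives a harmonic sum
    of at most [2 ^ 2 ^ c.+1] terms. *)
Lemma sum_ancestor_prob_side (lt : rel 'I_n) x c :
  transitive lt -> irreflexive lt -> (forall y z, y != z -> lt y z || lt z y) ->
  (forall y z, lt x z -> lt z y -> between x y z) ->
  \sum_(y in tier c | lt x y) ancestor_prob x y <= 24 * (2 ^ c.+1).+1%:R.
Proof.
move=> lt_trans lt_irr lt_total ltb.
pose S := [set y in tier c | lt x y]%SET.
rewrite (eq_bigl (mem S)) => [|y]; last by rewrite !inE.
apply: (@le_trans _ _ (\sum_(y in S) 24 / #|[set z in S | lt z y]%SET|.+1%:R)).
  apply: ler_sum => y; rewrite !inE => /andP[ly xy].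
  apply: le_trans (fine_prob_le (measurable_ancestor_event x y)
    (measurable_record delta y _) _) (prob_record_le unif indep _).
    move=> w /= /forallP h z; rewrite !inE => /andP[/andP[lz xz] zy].
    have /implyP/(_ (ltb _ _ xz zy)) := h z.
    by rewrite pri_le (eqP ly) (eqP lz) lerD2r.
  by rewrite !inE lt_irr andbF.
rewrite (sum_rank S (fun r => 24 / r.+1%:R)) // -mulr_sumr ler_pM2l //.
apply: harmonic_le; apply: leq_trans (card_tier c).
by apply/subset_leq_card/fintype.subsetP => y; rewrite inE => /andP[].
Qed.

Lemma sum_ancestor_prob_tier x c :
  \sum_(y in tier c | y != x) ancestor_prob x y <= 48 * (2 ^ c.+1).+1%:R.
Proof.
have -> : 48 = 24 + 24 :> R by rewrite -natrD.
rewrite mulrDl (bigID (fun y : 'I_n => (x < y)%N)) /=; apply: lerD.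
  rewrite (eq_bigl (fun y : 'I_n => (y \in tier c) && (x < y)%N)).
    apply: (@sum_ancestor_prob_side (fun y z : 'I_n => (y < z)%N)).
    - by move=> ? ? ?; exact: ltn_trans.
    - by move=> ?; rewrite ltnn.
    - by move=> y z; rewrite -neq_ltn.
    - by move=> y z; rewrite /between; lia.
  move=> y; rewrite -andbA; congr (_ && _).
  by case: eqVneq => [->|]; rewrite ?ltnn.
rewrite (eq_bigl (fun y : 'I_n => (y \in tier c) && (y < x)%N)).
  apply: (@sum_ancestor_prob_side (fun y z : 'I_n => (z < y)%N)).
  - by move=> ? ? ? zy yx; exact: ltn_trans yx zy.
  - by move=> ?; rewrite ltnn.
  - by move=> y z; rewrite -neq_ltn eq_sym.
  - by move=> y z; rewrite /between; lia.
move=> y; rewrite -andbA -leqNgt; congr (_ && _).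
by rewrite ltn_neqAle.
Qed.

Lemma sum_ancestor_prob x :
  \sum_y ancestor_prob x y <= 291 * at_least1 (log2 (q x)^-1).
Proof.
(* The number of nonnegative tiers not above [x]; none if the level of [x] is negative. *)
pose N := if level (q x) is Posz k then k.+1 else 0%N.
(* A negative level forces [q y * 2 >= 1], a level below [N] has its own summand, and a level above
   that of [x] has probability 0. *)
have ay y : y != x -> ancestor_prob x y <=
    q y * 2 + \sum_(j < N) (if y \in tier j then ancestor_prob x y else 0).
  move=> yx; have s0 : 0 <= \sum_(j < N) (if y \in tier j then ancestor_prob x y else 0).
    by apply: sumr_ge0 => j _; case: ifP => // _; exact: ancestor_prob_ge0.
  have qy0 := q_gt0 y.
  case ly : (level (q y)) => [j|j]; last first.
    have : 1 <= q y * 2 ^+ (2 ^ 0) by apply: level_lt => //; rewrite ly.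
    by have := ancestor_prob_le1 x y; rewrite expn0 expr1; lra.
  have [jN|Nj] := ltnP j N.
    rewrite (bigD1 (Ordinal jN)) //= inE ly eqxx addrCA lerDl addr_ge0 //.
      by rewrite mulr_ge0 // ltW.
    by apply: sumr_ge0 => i _; case: ifP => // _; exact: ancestor_prob_ge0.
  rewrite [X in X <= _]ancestor_prob_level_gt; last first.
    by rewrite ly; move: Nj; rewrite /N; case: (level _).
  by apply: addr_ge0 => //; rewrite mulr_ge0 // ltW.
rewrite (bigD1 x) //=.
(* 1 for [x] itself, 2 for twice the total weight, then the tiers. When [x] has level [k >= 0] the
   geometric sum is at most [288 * 2 ^ k], whence [291 = 1 + 2 + 288]. *)
apply: (@le_trans _ _ (1 + (2 + \sum_(j < N) 144 * 2 ^+ j))).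
  apply: lerD; first exact: ancestor_prob_le1.
  apply: le_trans (ler_sum _ ay) _; rewrite big_split /=; apply: lerD.
    rewrite -mulr_suml ler_piMl // -q_sum [X in _ <= X](bigD1 x) //= lerDr.
    exact: ltW.
  rewrite exchange_big /=; apply: ler_sum => j _.
  rewrite -big_mkcondr /= (eq_bigl (fun y => (y \in tier j) && (y != x))).
    apply: le_trans (sum_ancestor_prob_tier x j) _.
    (* [2 ^ j.+1 + 1 <= 3 * 2 ^ j] gives [144 = 48 * 3]. *)
    have -> : 144 * 2 ^+ j = 48 * (3 * 2 ^ j)%:R :> R by rewrite natrM natrX; ring.
    by rewrite ler_pM2l // ler_nat expnS; have := expn_gt0 2 j; lia.
  by move=> y; rewrite andbC.
have M1 : 1 <= at_least1 (log2 (q x)^-1) by rewrite le_max lexx.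
have geo k : \sum_(j < k) 144 * 2 ^+ j <= 144 * 2 ^+ k :> R.
  elim: k => [|k IHk]; first by rewrite big_ord0 mulr_ge0.
  by rewrite big_ord_recr /= exprS; lra.
have := geo N; rewrite /N; case lx : (level (q x)) => [k|k].
  by have := level_ge lx; rewrite exprS; lra.
by rewrite expr0; lra.
Qed.

(** The measurable majorant of the depth, a finite sum of indicators. *)
Let depth_bound (x : 'I_n) (w : T) : R := \sum_y \1_(ancestor_event x y) w.

Lemma depth_treap_le_bound x w : (depth (treap (pri w)) x)%:R <= depth_bound x w.
Proof.
apply: (@le_trans _ _ (\sum_y outranks (pri w) x y)%N%:R).
  by rewrite ler_nat; exact: depth_treap_le.
rewrite natr_sum; apply: ler_sum => y _; rewrite indicE.
case h : (outranks _ x y); first by rewrite mem_set.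
by rewrite ler0n.
Qed.

Lemma bounded_mfun_depth_bound x : bounded_mfun (depth_bound x).
Proof.
apply: bounded_mfun_sum => y; apply: bounded_mfun_indic.
exact: measurable_ancestor_event.
Qed.

Lemma mean_depth_bound x :
  mean P (depth_bound x) <= 291 * at_least1 (log2 (q x)^-1).
Proof.
rewrite mean_sum => [|y]; last first.
  by apply: bounded_mfun_indic; exact: measurable_ancestor_event.
rewrite (eq_bigr (ancestor_prob x)) => [|y _]; first exact: sum_ancestor_prob.
by rewrite mean_indic //; exact: measurable_ancestor_event.
Qed.

Lemma expected_depth_le x : ('E_P[fun w => (depth (treap (pri w)) x)%:R]
  <= (291 * at_least1 (log2 (q x)^-1))%:E)%E.
Proof.
apply: (@le_trans _ _ (mean P (depth_bound x))%:E).
  apply: expectation_le_mean; first by move=> w; rewrite ler0n.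
    exact: bounded_mfun_depth_bound.
  exact: depth_treap_le_bound.
by rewrite lee_fin mean_depth_bound.
Qed.

Lemma sum_log2_accesses m (X : m.-tuple 'I_n) :
  \sum_(i < m) log2 (q (tnth X i))^-1 = m%:R * cross_entropy (frequency R X) q.
Proof.
rewrite /cross_entropy mulr_sumr.
rewrite (partition_big (tnth X) xpredT) //=; apply: eq_bigr => x _.
rewrite (eq_bigr (fun=> log2 (q x)^-1)) => [|i /eqP -> //].
rewrite sumr_const /frequency -[LHS]mulr_natl cardsE mulrA; congr (_ * _).
(* For [m = 0] the frequency divides by 0, but no index is counted and both sides vanish. *)
case: m X => [|m] X; last by rewrite mulrC divfK // pnatr_eq0.
by rewrite mul0r; apply/eqP; rewrite pnatr_eq0; apply/eqP/eq_card0 => -[].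
Qed.

(** Since [log2 (1 / q x) >= 0], each maximum with 1 is at most a sum with 1. Adding over the
    accesses gives 1 plus the cross entropy, at most twice their maximum, hence [582 = 2 * 291]. *)
Lemma expected_access_cost_le m (X : m.-tuple 'I_n) :
  ('E_P[fun w => (access_cost X (treap (pri w)))%:R]
   <= (582 * (m%:R * at_least1 (cross_entropy (frequency R X) q)))%:E)%E.
Proof.
pose g w := \sum_(i < m) depth_bound (tnth X i) w.
apply: (@le_trans _ _ (mean P g)%:E).
  apply: expectation_le_mean; first by move=> w; rewrite ler0n.
    by apply: bounded_mfun_sum => i; exact: bounded_mfun_depth_bound.
  move=> w; rewrite /access_cost natr_sum; apply: ler_sum => i _.
  exact: depth_treap_le_bound.
rewrite lee_fin mean_sum => [|i]; last exact: bounded_mfun_depth_bound.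
have L0 x : 0 <= log2 (q x)^-1.
  have l2 : 0 < ln 2 :> R by rewrite ln_gt0 // ltr1n.
  rewrite divr_ge0 ?(ltW l2) // ln_ge0 // invf_ge1 // -q_sum (bigD1 x) //= lerDl.
  by apply: sumr_ge0 => y _; exact: ltW.
apply: (@le_trans _ _ (\sum_(i < m) 291 * (1 + log2 (q (tnth X i))^-1))).
  apply: ler_sum => i _; apply: le_trans (mean_depth_bound _) _.
  by rewrite ler_pM2l ?ltr0n // /at_least1 ge_max lerDl L0 lerDr ler01.
rewrite -mulr_sumr big_split /= sum_log2_accesses sumr_const card_ord.
have M1 : 1 <= at_least1 (cross_entropy (frequency R X) q) by rewrite le_max lexx.
have Me : cross_entropy (frequency R X) q <= at_least1 (cross_entropy (frequency R X) q).
  by rewrite le_max lexx orbT.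
have : m%:R * (1 + cross_entropy (frequency R X) q) <=
    m%:R * (2 * at_least1 (cross_entropy (frequency R X) q)).
  by rewrite ler_wpM2l ?ler0n //; lra.
by lra.
Qed.

End ExpectedDepth.

(** * Both bounds with one constant *)

Theorem mainTheorem4 (R : realType) :
  exists2 C : R, 0 < C &
  forall (n m : nat) (X : m.-tuple 'I_n) (q : 'I_n -> R)
    (d : measure_display) (T : measurableType d) (P : probability T R)
    (delta : 'I_n -> {RV P >-> R}),
  (forall x, 0 < q x) ->
  \sum_(x < n) q x = 1 ->
  (forall x, uniform01 (delta x)) ->
  kwise_independent 11 delta ->
  let Treap (w : T) : tree n := treap (priority q (fun x => delta x w)) in
  (forall x : 'I_n,
     ('E_P[fun w => (depth (Treap w) x)%:R]
       <= (C * at_least1 (log2 (q x)^-1))%:E)%E) /\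
  ('E_P[fun w => (access_cost X (Treap w))%:R]
     <= (C * (m%:R * at_least1 (cross_entropy (frequency R X) q)))%:E)%E.
Proof.
(* The larger of the constants 291 for the depth and 582 for the access cost. *)
exists 582; first by rewrite ltr0n.
move=> n m X q d T P delta q_gt0 q_sum unif indep11 Treap.
have indep : kwise_independent 5 delta.
  by move=> J B J5 mB; apply: indep11 => //; apply: leq_trans J5 _.
split=> [x|]; last exact: expected_access_cost_le.
apply: le_trans (expected_depth_le q_gt0 q_sum unif indep x) _.
rewrite lee_fin ler_wpM2r //; last by rewrite ler_nat.
by apply: le_trans ler01 _; rewrite le_max lexx.
Qed.
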